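(* Let $\mathbb{F}$ be a field with $\mathrm{Char}(\mathbb{F})=2$. With the algebras $A_{1,2},\dots,A_{11,2}$ over $\mathbb{F}$ and the sets of matrices $Aut(A)$, $Der(A)$ as defined in the context, the following hold for all admissible values of the parameters. 1. $Aut(A_{1,2}(\alpha_1,\alpha_2,\alpha_4,\beta_1))=\{I\}$ and $Der(A_{1,2}(\alpha_1,\alpha_2,\alpha_4,\beta_1))=\{0\}$. 2. $Aut(A_{2,2}(\alpha_1,\alpha_4,\beta_2))=\{I\}$ if $\alpha_4\neq0$; $Der(A_{2,2}(\alpha_1,\alpha_4,\beta_2))=\{0\}$ if $\alpha_4\neq0$ or $\beta_2\neq1$ (for admissible parameters). $Aut(A_{2,2}(\alpha_1,0,1))=\left\{\begin{pmatrix}1&0\\c&1\end{pmatrix}: c\in\mathbb{F}\right\}$ and $Der(A_{2,2}(\alpha_1,0,1))=\left\{\begin{pmatrix}0&0\\c&0\end{pmatrix}: c\in\mathbb{F}\right\}$. 3. $Aut(A_{3,2}(\alpha_1,\alpha_4,\beta_2))=\left\{\begin{pmatrix}1&0\\0&\pm1\end{pmatrix}\right\}$ if $\alpha_4\neq0$; $Aut(A_{3,2}(\alpha_1,0,\beta_2))=\left\{\begin{pmatrix}1&0\\0&d\end{pmatrix}: d\in\mathbb{F}, d\neq0\right\}$ if $\beta_2\neq1$; $Der(A_{3,2}(\alpha_1,\alpha_4,\beta_2))=\left\{\begin{pmatrix}0&0\\0&d\end{pmatrix}: d\in\mathbb{F}\right\}$ if $\alpha_4\neq0$ or $\beta_2\neq1$;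 $Aut(A_{3,2}(\alpha_1,0,1))=\left\{\begin{pmatrix}1&0\\c&d\end{pmatrix}: c,d\in\mathbb{F}, d\neq0\right\}$ and $Der(A_{3,2}(\alpha_1,0,1))=\left\{\begin{pmatrix}0&0\\c&d\end{pmatrix}: c,d\in\mathbb{F}\right\}$. 4. $Aut(A_{4,2}(\alpha_1,\beta_1,\beta_2))=\left\{I,\begin{pmatrix}1&0\\1+\beta_2&1\end{pmatrix}\right\}$; $Der(A_{4,2}(\alpha_1,\beta_1,\beta_2))=\{0\}$ if $\beta_2\neq1$; $Der(A_{4,2}(\alpha_1,\beta_1,1))=\left\{\begin{pmatrix}0&0\\c&0\end{pmatrix}: c\in\mathbb{F}\right\}$. 5. If $\alpha_4\neq0$: $Aut(A_{5,2}(\alpha_1,\alpha_4))=\{I\}$ and $Der(A_{5,2}(\alpha_1,\alpha_4))=\{0\}$. $Aut(A_{5,2}(1,0))=\left\{\begin{pmatrix}1&0\\c&1\end{pmatrix}: c\in\mathbb{F}\right\}$ and $Der(A_{5,2}(1,0))=\left\{\begin{pmatrix}0&0\\c&0\end{pmatrix}: c\in\mathbb{F}\right\}$. 6. $Aut(A_{6,2}(\alpha_1,\alpha_4))=\{I\}$ if $\alpha_4\neq0$; $Aut(A_{6,2}(\alpha_1,0))=\left\{\begin{pmatrix}1&0\\0&d\end{pmatrix}: d\in\mathbb{F}, d\neq0\right\}$ if $\alpha_1\neq1$; $Der(A_{6,2}(\alpha_1,\alpha_4))=\left\{\begin{pmatrix}0&0\\0&d\end{pmatrix}: d\in\mathbb{F}\right\}$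 if $\alpha_1\neq1$ or $\alpha_4\neq0$; $Aut(A_{6,2}(1,0))=\left\{\begin{pmatrix}1&0\\c&d\end{pmatrix}: c,d\in\mathbb{F}, d\neq0\right\}$ and $Der(A_{6,2}(1,0))=\left\{\begin{pmatrix}0&0\\c&d\end{pmatrix}: c,d\in\mathbb{F}\right\}$. 7. $Aut(A_{7,2}(\alpha_1,\beta_1))=\left\{I,\begin{pmatrix}1&0\\\alpha_1+1&1\end{pmatrix}\right\}$; $Der(A_{7,2}(\alpha_1,\beta_1))=\{0\}$ if $\alpha_1\neq1$; $Der(A_{7,2}(1,\beta_1))=\left\{\begin{pmatrix}0&0\\c&0\end{pmatrix}: c\in\mathbb{F}\right\}$. 8. If $\beta_1\neq0$: $Aut(A_{8,2}(\beta_1))=\{I\}\cup S_1\cup S_2$, where $$S_1=\left\{\begin{pmatrix}1+d&1+d+d^2\\1&d\end{pmatrix}: d\in\mathbb{F},\ d^2+d+1\neq0,\ \beta_1=\frac{1}{d^2+d+1}\right\},$$ $$S_2=\left\{\begin{pmatrix}d&d+d^2\\\frac{1+d}{d}&d\end{pmatrix}: d\in\mathbb{F},\ d\neq0,\ \beta_1=\frac{1+d}{d^3}\right\},$$ and $Der(A_{8,2}(\beta_1))=\{0\}$. $Aut(A_{8,2}(0))=\left\{\begin{pmatrix}1+b&b\\0&1\end{pmatrix}: b\in\mathbb{F},\ 1+b\neq0\right\}$ and $Der(A_{8,2}(0))=\left\{\begin{pmatrix}a&a\\c&c\end{pmatrix}: a,c\in\mathbb{F}\right\}$. 9. If $\beta_1\neq0$: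 $Aut(A_{9,2}(\beta_1))=\left\{\begin{pmatrix}d^2&0\\0&d\end{pmatrix}: d\in\mathbb{F}, d^3=1\right\}\cup\left\{\begin{pmatrix}0&b\\\frac1b&0\end{pmatrix}: b\in\mathbb{F}, b\neq0, \beta_1=\frac{1}{b^3}\right\}$ and $Der(A_{9,2}(\beta_1))=\{0\}$. $Aut(A_{9,2}(0))=\left\{\begin{pmatrix}d^2&b\\0&d\end{pmatrix}: b,d\in\mathbb{F}, d\neq0\right\}$ and $Der(A_{9,2}(0))=\left\{\begin{pmatrix}0&b\\0&d\end{pmatrix}: b,d\in\mathbb{F}\right\}$. 10. $Aut(A_{10,2}(\beta_1))$ consists of $I$, $\begin{pmatrix}1&0\\1&1\end{pmatrix}$ and all the matrices $$\begin{pmatrix}d&1\\1+d^2&d\end{pmatrix},\quad\begin{pmatrix}d&1\\1+d+d^2&1+d\end{pmatrix},\quad\begin{pmatrix}1+d&1\\1+d+d^2&d\end{pmatrix},\quad\begin{pmatrix}1+d&1\\d^2&1+d\end{pmatrix}$$ with $d\in\mathbb{F}$ satisfying $\beta_1=d+d^2$; and $Der(A_{10,2}(\beta_1))=\{0\}$. 11. $Aut(A_{11,2}(\beta_1))=\left\{\begin{pmatrix}a&0\\c&1\end{pmatrix}: a,c\in\mathbb{F},\ a\neq0,\ c^2=(1+a^2)\beta_1\right\}$ and $Der(A_{11,2}(\beta_1))=\left\{\begin{pmatrix}a&0\\c&0\end{pmatrix}: a,c\in\mathbb{F}\right\}$.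
   Context: An algebra over $\mathbb{F}$ is a vector space with a bilinear multiplication (no associativity, commutativity or unit is assumed). A two-dimensional algebra with a fixed basis $e=(e_1,e_2)$ is identified with its matrix of structure constants $$A=\begin{pmatrix}\alpha_1&\alpha_2&\alpha_3&\alpha_4\\\beta_1&\beta_2&\beta_3&\beta_4\end{pmatrix},$$ meaning $e_1e_1=\alpha_1e_1+\beta_1e_2$, $e_1e_2=\alpha_2e_1+\beta_2e_2$, $e_2e_1=\alpha_3e_1+\beta_3e_2$, $e_2e_2=\alpha_4e_1+\beta_4e_2$; equivalently $(eu)\cdot(ev)=eA(u\otimes v)$ for column vectors $u,v\in\mathbb{F}^2$, where $\otimes$ is the Kronecker product. A linear map is identified with its matrix in the basis $e$, acting on column coordinate vectors (columns are the coordinates of the images of $e_1,e_2$). An automorphism is an invertible linear map $\mathbf{g}$ with $\mathbf{g}(\mathbf{u}\cdot\mathbf{v})=\mathbf{g}(\mathbf{u})\cdot\mathbf{g}(\mathbf{v})$; a derivation is a linear map $\mathbf{D}$ with $\mathbf{D}(\mathbf{u}\cdot\mathbf{v})=\mathbf{D}(\mathbf{u})\cdot\mathbf{v}+\mathbf{u}\cdot\mathbf{D}(\mathbf{v})$. Thus $Aut(A)=\{g\in GL(2,\mathbb{F}): gA=A(g\otimes g)\}$ and $Der(A)=\{D\in Mat(2;\mathbb{F}): DA=A(D\otimes I+I\otimes D)\}$, where $I$ is the $2\times2$ identity matrix. $\mathbb{F}^*=\mathbb{F}\setminus\{0\}$. The algebras (for $\mathrm{Char}(\mathbb{F})=2$):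 - $A_{1,2}(\alpha_1,\alpha_2,\alpha_4,\beta_1)=\begin{pmatrix}\alpha_1&\alpha_2&\alpha_2+1&\alpha_4\\\beta_1&\alpha_1&1+\alpha_1&\alpha_2\end{pmatrix}$, $(\alpha_1,\alpha_2,\alpha_4,\beta_1)\in\mathbb{F}^4$; - $A_{2,2}(\alpha_1,\alpha_4,\beta_2)=\begin{pmatrix}\alpha_1&0&0&\alpha_4\\1&\beta_2&1+\alpha_1&0\end{pmatrix}$, where the admissible parameters are $(\alpha_1,\alpha_4,\beta_2)\in\mathbb{F}^3$ with either $\alpha_4\in\mathbb{F}^*$, or $(\alpha_4,\beta_2)=(0,1)$; - $A_{3,2}(\alpha_1,\alpha_4,\beta_2)=\begin{pmatrix}\alpha_1&0&0&\alpha_4\\0&\beta_2&1+\alpha_1&0\end{pmatrix}$, $(\alpha_1,\alpha_4,\beta_2)\in\mathbb{F}^3$; - $A_{4,2}(\alpha_1,\beta_1,\beta_2)=\begin{pmatrix}\alpha_1&1&1&0\\\beta_1&\beta_2&1+\alpha_1&1\end{pmatrix}$, $(\alpha_1,\beta_1,\beta_2)\in\mathbb{F}^3$; - $A_{5,2}(\alpha_1,\alpha_4)=\begin{pmatrix}\alpha_1&0&0&\alpha_4\\1&1+\alpha_1&\alpha_1&0\end{pmatrix}$, where the admissible parameters are $(\alpha_1,\alpha_4)\in\mathbb{F}^2$ with either $\alpha_4\in\mathbb{F}^*$, or $(\alpha_1,\alpha_4)=(1,0)$; - $A_{6,2}(\alpha_1,\alpha_4)=\begin{pmatrix}\alpha_1&0&0&\alpha_4\\0&1+\alpha_1&\alpha_1&0\end{pmatrix}$,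 $(\alpha_1,\alpha_4)\in\mathbb{F}^2$; - $A_{7,2}(\alpha_1,\beta_1)=\begin{pmatrix}\alpha_1&1&1&0\\\beta_1&1+\alpha_1&\alpha_1&1\end{pmatrix}$, $(\alpha_1,\beta_1)\in\mathbb{F}^2$; - $A_{8,2}(\beta_1)=\begin{pmatrix}0&1&1&1\\\beta_1&0&0&-1\end{pmatrix}$, $\beta_1\in\mathbb{F}$; - $A_{9,2}(\beta_1)=\begin{pmatrix}0&0&0&1\\\beta_1&0&0&0\end{pmatrix}$, $\beta_1\in\mathbb{F}$; - $A_{10,2}(\beta_1)=\begin{pmatrix}1&1&1&0\\\beta_1&1&1&1\end{pmatrix}$, $\beta_1\in\mathbb{F}$; - $A_{11,2}(\beta_1)=\begin{pmatrix}0&1&1&0\\\beta_1&0&0&1\end{pmatrix}$, $\beta_1\in\mathbb{F}$. *)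

(* Defs.v *)
From mathcomp Require Import all_boot all_order all_algebra.
From mathcomp Require Import boolp classical_sets.
From mathcomp.real_closed Require Import mxtens.

Set Implicit Arguments.
Unset Strict Implicit.
Unset Printing Implicit Defensive.

Import GRing.Theory.
Local Open Scope ring_scope.
Local Open Scope classical_set_scope.

Section TwoDimAlgebras.
Variable F : fieldType.
Implicit Types (A : 'M[F]_(2, 2 * 2)) (a b c d : F).

Definition mx22 a b c d : 'M[F]_2 :=
  \matrix_(i, j) nth 0 (nth [::] [:: [:: a; b]; [:: c; d]] i) j.

(* Column [2 * i + j] holds the coordinates of the product e_(i+1) e_(j+1), *)
(* which is the column ordering used by the Kronecker product [*t].         *)
Definition mx24 (a1 a2 a3 a4 b1 b2 b3 b4 : F) : 'M[F]_(2, 2 * 2) :=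
  \matrix_(i, j)
    nth 0 (nth [::] [:: [:: a1; a2; a3; a4]; [:: b1; b2; b3; b4]] i) j.

Definition algAut A : set 'M[F]_2 :=
  [set g | g \in unitmx /\ g *m A = A *m (g *t g)].

Definition algDer A : set 'M[F]_2 :=
  [set D | D *m A = A *m (D *t 1%:M + 1%:M *t D)].

Definition A1_2 (a1 a2 a4 b1 : F) :=
  mx24 a1 a2 (a2 + 1) a4
       b1 a1 (1 + a1) a2.

Definition A2_2 (a1 a4 b2 : F) :=
  mx24 a1 0 0 a4
       1 b2 (1 + a1) 0.

Definition A2_2_admissible (a1 a4 b2 : F) : Prop :=
  a4 != 0 \/ (a4, b2) = (0, 1).

Definition A3_2 (a1 a4 b2 : F) :=
  mx24 a1 0 0 a4
       0 b2 (1 + a1) 0.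

Definition A4_2 (a1 b1 b2 : F) :=
  mx24 a1 1 1 0
       b1 b2 (1 + a1) 1.

(* The admissible parameters of [A5_2] are those with [a4 != 0], together   *)
(* with [(a1, a4) = (1, 0)].                                                *)
Definition A5_2 (a1 a4 : F) :=
  mx24 a1 0 0 a4
       1 (1 + a1) a1 0.

Definition A6_2 (a1 a4 : F) :=
  mx24 a1 0 0 a4
       0 (1 + a1) a1 0.

Definition A7_2 (a1 b1 : F) :=
  mx24 a1 1 1 0
       b1 (1 + a1) a1 1.

Definition A8_2 (b1 : F) :=
  mx24 0 1 1 1
       b1 0 0 (-1).

Definition A9_2 (b1 : F) :=
  mx24 0 0 0 1
       b1 0 0 0.

Definition A10_2 (b1 : F) :=
  mx24 1 1 1 0
       b1 1 1 1.

Definition A11_2 (b1 : F) :=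
  mx24 0 1 1 0
       b1 0 0 1.

End TwoDimAlgebras.

(* Main.v *)
Require Import Defs.
From Stdlib Require Import Ring_theory Ring_base Ring_tac.
From mathcomp Require Import all_boot all_order all_algebra.
From mathcomp Require Import boolp classical_sets.
From mathcomp.real_closed Require Import mxtens.

Set Implicit Arguments.
Unset Strict Implicit.
Unset Printing Implicit Defensive.

Import GRing.Theory.
Local Open Scope ring_scope.
Local Open Scope classical_set_scope.

(** Write g = (a b; c d) for an automorphism or a derivation. The membership
    condition is a system of eight polynomial equations, one per entry of a
    2 x 4 matrix. Solving it takes only cancellation of nonzero factors and
    linear combinations of equations, computed modulo 2.

    What makes the eleven systems tractable is the trace. If L_u is left
    multiplication by u, an automorphism satisfies L_(g u) = g L_u g^-1, and a
    derivation satisfies L_(D u) = [D, L_u]. Hence the linear form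
    u |-> tr L_u is fixed by every automorphism and killed by every
    derivation, and likewise for right multiplications, that is for the
    opposite algebra ([algAut_trace], [algDer_trace]).

    - For A1 the left and right trace forms are the two coordinate forms, so
      g = 1 and D = 0 at once.
    - For A2 to A7 one of the two forms is the first coordinate, so the first
      row of g is (1 0) and that of D is (0 0). Two unknowns c, d are left,
      and the algebras fall into two families. In the family of A2, A3, A5,
      A6 (e1 e2 and e2 e1 are multiples of e2, and e2 e2 of e1) the system
      becomes c a4 = 0, d^2 a4 = a4, c s = (1 + d) b1 with
      s = a1 + b2 + b3. In the family of A4 and A7 (where e2 is idempotent)
      it becomes d = 1, c (c + s) = 0.
    - A8 to A11 are commutative with both trace forms zero, and the quadratic
      equations expressing g (u u) = (g u) (g u) on the basis are solved
      directly. For A8 with b1 != 0 they give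
      (a + d) (a + d + 1) = 0: the first factor yields the identity and one
      family of automorphisms, the second factor the other family. For A10
      the equation b = b^2 separates the two matrices with b = 0 from those
      with b = 1, whose diagonal entries solve x + x^2 = b1. *)

(** * Coordinates *)

Section Coordinates.
Variable F : fieldType.
Implicit Types a b c d : F.

Lemma mx22_eta (g : 'M[F]_2) : exists a b c d, g = mx22 a b c d.
Proof.
exists (g ord0 ord0), (g ord0 ord_max), (g ord_max ord0), (g ord_max ord_max).
by apply/matrixP=> i j; rewrite !mxE; case: i => -[|[|[]]] // i;
  case: j => -[|[|[]]] // j /=; congr (g _ _); apply: val_inj.
Qed.

Lemma mx22_1 : 1%:M = mx22 1 0 0 1 :> 'M[F]_2.
Proof.
by apply/matrixP=> -[[|[|[]]] // i] [[|[|[]]] // j]; rewrite !mxE.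
Qed.

Lemma mx22_0 : 0 = mx22 0 0 0 0 :> 'M[F]_2.
Proof.
by apply/matrixP=> -[[|[|[]]] // i] [[|[|[]]] // j]; rewrite !mxE.
Qed.

Lemma det_mx22 a b c d : \det (mx22 a b c d) = a * d - b * c.
Proof.
rewrite (expand_det_row _ ord0) !big_ord_recl big_ord0 /cofactor !det_mx11.
by rewrite !mxE /= expr0 expr1 addr0 mul1r mulN1r mulrN.
Qed.

Lemma mxtrace_mx22 a b c d : \tr (mx22 a b c d) = a + d.
Proof. by rewrite /mxtrace !big_ord_recl big_ord0 !mxE addr0. Qed.

Lemma mul_mx22 a b c d a' b' c' d' :
  mx22 a b c d *m mx22 a' b' c' d' =
  mx22 (a * a' + b * c') (a * b' + b * d')
       (c * a' + d * c') (c * b' + d * d').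
Proof.
by apply/matrixP=> -[[|[|[]]] // i] [[|[|[]]] // j];
  rewrite !mxE !big_ord_recl big_ord0 !mxE addr0.
Qed.

Lemma mx24_inj a1 a2 a3 a4 b1 b2 b3 b4 c1 c2 c3 c4 d1 d2 d3 d4 :
  mx24 a1 a2 a3 a4 b1 b2 b3 b4 = mx24 c1 c2 c3 c4 d1 d2 d3 d4 <->
  [/\ a1 = c1, a2 = c2, a3 = c3 & a4 = c4] /\
  [/\ b1 = d1, b2 = d2, b3 = d3 & b4 = d4].
Proof.
split=> [/matrixP e | [[-> -> -> ->] [-> -> -> ->]] //].
have col j (j4 : (j < 2 * 2)%N) :=
  (e ord0 (Ordinal j4), e ord_max (Ordinal j4)).
move: (col 0%N isT) (col 1%N isT) (col 2%N isT) (col 3%N isT).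
by rewrite !mxE /= => -[-> ->] [-> ->] [-> ->] [-> ->].
Qed.

Lemma mul_mx22_mx24 a b c d a1 a2 a3 a4 b1 b2 b3 b4 :
  mx22 a b c d *m mx24 a1 a2 a3 a4 b1 b2 b3 b4 =
  mx24 (a * a1 + b * b1) (a * a2 + b * b2) (a * a3 + b * b3) (a * a4 + b * b4)
       (c * a1 + d * b1) (c * a2 + d * b2) (c * a3 + d * b3) (c * a4 + d * b4).
Proof.
by apply/matrixP=> -[[|[|[]]] // i] [[|[|[|[|[]]]]] // j];
  rewrite !mxE !big_ord_recl big_ord0 !mxE addr0.
Qed.

Lemma mul_mx24_tens a1 a2 a3 a4 b1 b2 b3 b4 a b c d a' b' c' d' :
  mx24 a1 a2 a3 a4 b1 b2 b3 b4 *m (mx22 a b c d *t mx22 a' b' c' d') =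
  let row x1 x2 x3 x4 u v w z :=
    x1 * (u * w) + x2 * (u * z) + x3 * (v * w) + x4 * (v * z) in
  let fst := row a1 a2 a3 a4 in let snd := row b1 b2 b3 b4 in
  mx24 (fst a c a' c') (fst a c b' d') (fst b d a' c') (fst b d b' d')
       (snd a c a' c') (snd a c b' d') (snd b d a' c') (snd b d b' d').
Proof.
by apply/matrixP=> -[[|[|[]]] // i] [[|[|[|[|[]]]]] // j];
  rewrite !mxE !big_ord_recl big_ord0 /= !mxE /= addr0 !addrA.
Qed.

Lemma add_mx24 a1 a2 a3 a4 b1 b2 b3 b4 c1 c2 c3 c4 d1 d2 d3 d4 :
  mx24 a1 a2 a3 a4 b1 b2 b3 b4 + mx24 c1 c2 c3 c4 d1 d2 d3 d4 =
  mx24 (a1 + c1) (a2 + c2) (a3 + c3) (a4 + c4)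
       (b1 + d1) (b2 + d2) (b3 + d3) (b4 + d4) :> 'M[F]_(2, 2 * 2).
Proof.
by apply/matrixP=> -[[|[|[]]] // i] [[|[|[|[|[]]]]] // j]; rewrite !mxE.
Qed.

End Coordinates.

(** * Polynomial identities modulo 2 *)

Section CharTwo.
Variables (F : fieldType) (charF2 : 2%N \in [pchar F]).
Implicit Types a b c d x y : F.

(** The [ring] tactic compares operators up to syntax, whereas structure
    inference reaches the operations of [F] along several convertible paths.
    These constants give each operation a single name. *)
Definition addF x y : F := x + y.
Definition mulF x y : F := x * y.
Definition oppF x : F := - x.
Definition subF x y : F := x - y.
Definition expF x (n : nat) : F := x ^+ n.
Definition zeroF : F := 0.
Definition oneF : F := 1.

Lemma char2_ring_theory : ring_theory zeroF oneF addF mulF subF oppF eq.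
Proof.
split=> //; [exact: add0r | exact: addrC | exact: addrA | exact: mul1r
  | exact: mulrC | exact: mulrA | exact: mulrDl | exact: subrr].
Qed.

(** Taking the two-element field, encoded by [bool] with [xorb] and [andb], as
    the coefficient ring makes normal forms be computed modulo 2. *)
Lemma char2_ring_morph :
  ring_morph zeroF oneF addF mulF subF oppF eq
    false true xorb andb xorb id Bool.eqb (fun x : bool => x%:R : F).
Proof.
rewrite /zeroF /oneF /addF /mulF /subF /oppF.
have two0 : 1 + 1 = 0 :> F by exact: addrr_pchar2.
split=> //=.
- by case=> -[] //=; rewrite ?addr0 ?add0r ?two0.
- by case=> -[] //=; rewrite ?subr0 ?subrr // sub0r oppr_pchar2.
- by case=> -[] //=; rewrite ?mulr0 ?mulr1 ?mul0r.
- by case=> //=; rewrite ?oppr0 ?oppr_pchar2.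
- by case=> -[].
Qed.

Lemma char2_power_theory :
  power_theory oneF mulF eq BinNat.N.to_nat expF.
Proof.
rewrite /oneF /mulF /expF.
split=> x [|p] //=; elim: p => [p IH | p IH |] //=.
- by rewrite -IH Pnat.Pos2Nat.inj_xI multE mul2n -addnn exprS exprD.
- by rewrite -IH Pnat.Pos2Nat.inj_xO multE mul2n -addnn exprD.
Qed.

Ltac no_constant t := constr:(InitialRing.NotConstant).
Ltac nat_exponent t := eval compute in (BinNat.N.of_nat t).
Add Ring char2_ring : char2_ring_theory
  (morphism char2_ring_morph, constants [no_constant],
   power_tac char2_power_theory [nat_exponent]).

(** Renames the operations in a term, whatever path they were inferred by. *)
Ltac monomorphic t :=
  lazymatch t with
  | @Algebra.add _ ?x ?y =>
      let x' := monomorphic x in let y' := monomorphic y in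
      constr:(addF x' y')
  | @GRing.mul _ ?x ?y =>
      let x' := monomorphic x in let y' := monomorphic y in
      constr:(mulF x' y')
  | @GRing.exp _ ?x ?n => let x' := monomorphic x in constr:(expF x' n)
  | @Algebra.opp _ ?x => let x' := monomorphic x in constr:(oppF x')
  | @Algebra.zero _ => constr:(zeroF)
  | GRing.one _ => constr:(oneF)
  | _ => t
  end.

Ltac char2_ring :=
  match goal with |- ?x = ?y =>
    let x' := monomorphic x in let y' := monomorphic y in
    change (x' = y'); ring
  end.

Lemma eq_add {x y x' y' : F} : x = y -> x' = y' -> x + x' = y + y'.
Proof. by move=> -> ->. Qed.

Lemma eq_scale c {x y : F} : x = y -> c * x = c * y.
Proof. by move=> ->. Qed.

(** In characteristic 2 an equation x = y is the vanishing of x + y, so it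
    follows from u = v as soon as x + y = u + v identically. Here u = v is in
    practice a linear combination of hypotheses, built by the two notations
    below, whose coefficients are the certificate. *)
Lemma char2_lincomb {x y u v : F} : u = v -> x + y = u + v -> x = y.
Proof.
move=> -> /eqP; rewrite addrr_pchar2 // addr_eq0 oppr_pchar2 //.
by move/eqP.
Qed.

Local Notation "h '+e' k" := (eq_add h k) (at level 50, left associativity).
Local Notation "c '*e' h" := (eq_scale c h) (at level 40).
Ltac comb h := apply: (char2_lincomb h); char2_ring.

Lemma char2_add_eq0 x y : (x + y == 0) = (x == y).
Proof. by rewrite addr_eq0 oppr_pchar2. Qed.

Lemma char2_sqr_inj x y : x ^+ 2 = y ^+ 2 -> x = y.
Proof.
move=> e; apply/eqP; rewrite -char2_add_eq0 -sqrf_eq0; apply/eqP; comb e.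
Qed.

Lemma char2_add1_neq0 x : x != 1 -> 1 + x != 0.
Proof. by rewrite char2_add_eq0 eq_sym. Qed.

(** * Automorphisms and derivations in coordinates *)

(** The two groups are the e1- and e2-coordinates of the images of e1 e1,
    e1 e2, e2 e1, e2 e2. The first condition is invertibility, with the
    determinant written as in characteristic 2. *)
Lemma algAut_mx22 a1 a2 a3 a4 b1 b2 b3 b4 a b c d :
  algAut (mx24 a1 a2 a3 a4 b1 b2 b3 b4) (mx22 a b c d) <->
  [/\ a * d + b * c != 0,
  [/\ a * a1 + b * b1 = a ^+ 2 * a1 + a * c * (a2 + a3) + c ^+ 2 * a4,
      a * a2 + b * b2 = a * b * a1 + a * d * a2 + c * b * a3 + c * d * a4,
      a * a3 + b * b3 = a * b * a1 + c * b * a2 + a * d * a3 + c * d * a4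
    & a * a4 + b * b4 = b ^+ 2 * a1 + b * d * (a2 + a3) + d ^+ 2 * a4]
& [/\ c * a1 + d * b1 = a ^+ 2 * b1 + a * c * (b2 + b3) + c ^+ 2 * b4,
      c * a2 + d * b2 = a * b * b1 + a * d * b2 + c * b * b3 + c * d * b4,
      c * a3 + d * b3 = a * b * b1 + c * b * b2 + a * d * b3 + c * d * b4
    & c * a4 + d * b4 = b ^+ 2 * b1 + b * d * (b2 + b3) + d ^+ 2 * b4]].
Proof.
rewrite /algAut /= unitmxE unitfE det_mx22 oppr_pchar2 //.
rewrite mul_mx22_mx24 mul_mx24_tens mx24_inj /=.
split=> [[Hd [[e1 e2 e3 e4] [f1 f2 f3 f4]]] | [Hd [e1 e2 e3 e4] [f1 f2 f3 f4]]].
  split=> //; split; [comb e1 | comb e2 | comb e3 | comb e4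
    | comb f1 | comb f2 | comb f3 | comb f4].
split=> //; split; split; [comb e1 | comb e2 | comb e3 | comb e4
    | comb f1 | comb f2 | comb f3 | comb f4].
Qed.

(** The system is shortened by cancelling pairs: the term a a2 occurs both in
    D (e1 e2) and in (D e1) e2, and the multiples of e_i e_i in (D e_i) e_i
    and e_i (D e_i) are equal. *)
Lemma algDer_mx22 a1 a2 a3 a4 b1 b2 b3 b4 a b c d :
  algDer (mx24 a1 a2 a3 a4 b1 b2 b3 b4) (mx22 a b c d) <->
  [/\ a * a1 + b * b1 = c * (a2 + a3),
      b * b2 = b * a1 + d * a2 + c * a4,
      b * b3 = b * a1 + d * a3 + c * a4
    & a * a4 + b * b4 = b * (a2 + a3)] /\
  [/\ c * a1 + d * b1 = c * (b2 + b3),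
      c * a2 = b * b1 + a * b2 + c * b4,
      c * a3 = b * b1 + a * b3 + c * b4
    & c * a4 + d * b4 = b * (b2 + b3)].
Proof.
rewrite /algDer /= mulmxDr mx22_1.
rewrite mul_mx22_mx24 !mul_mx24_tens add_mx24 mx24_inj /=.
split=> [] [[e1 e2 e3 e4] [f1 f2 f3 f4]].
  split; split; [comb e1 | comb e2 | comb e3 | comb e4
    | comb f1 | comb f2 | comb f3 | comb f4].
split; split; [comb e1 | comb e2 | comb e3 | comb e4
    | comb f1 | comb f2 | comb f3 | comb f4].
Qed.

(** The commutation of g with the product is symmetric in the two factors, so
    an algebra and its opposite, obtained by exchanging the two middle
    columns, have the same automorphisms. *)
Lemma algAut_opp a1 a2 a3 a4 b1 b2 b3 b4 a b c d :
  algAut (mx24 a1 a2 a3 a4 b1 b2 b3 b4) (mx22 a b c d) ->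
  algAut (mx24 a1 a3 a2 a4 b1 b3 b2 b4) (mx22 a b c d).
Proof.
move=> /algAut_mx22[Hd [e1 e2 e3 e4] [f1 f2 f3 f4]].
apply/algAut_mx22; split=> //; split; [comb e1 | comb e3 | comb e2 | comb e4
  | comb f1 | comb f3 | comb f2 | comb f4].
Qed.

(** * Invariance of the trace forms *)

(** The columns of g A = A (g (x) g), taken two by two, say that left
    multiplication by g e_i is conjugate under g to left multiplication by
    e_i; conjugate matrices have the same trace. *)
Lemma algAut_trace a1 a2 a3 a4 b1 b2 b3 b4 a b c d :
  algAut (mx24 a1 a2 a3 a4 b1 b2 b3 b4) (mx22 a b c d) ->
  a * (a1 + b2) + c * (a3 + b4) = a1 + b2 /\
  b * (a1 + b2) + d * (a3 + b4) = a3 + b4.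
Proof.
set g := mx22 a b c d => Ag.
have gU : g \in unitmx by case: Ag.
have tr_conj M N : M *m g = g *m N -> \tr M = \tr N.
  move=> eMN; rewrite -[M](mulmxK gU) eMN -mulmxA mxtrace_mulC -mulmxA.
  by rewrite mulVmx // mulmx1.
move/algAut_mx22: Ag => [_ [e1 e2 e3 e4] [f1 f2 f3 f4]].
split.
(* The first factor is left multiplication by g e_1 = a e_1 + c e_2. *)
- have /tr_conj : mx22 (a * a1 + c * a3) (a * a2 + c * a4)
                      (a * b1 + c * b3) (a * b2 + c * b4) *m g
                = g *m mx22 a1 a2 b1 b2.
    rewrite !mul_mx22; congr mx22; [comb e1 | comb e2 | comb f1 | comb f2].
  by rewrite !mxtrace_mx22 => h; comb h.
(* The same for g e_2 = b e_1 + d e_2. *)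
have /tr_conj : mx22 (b * a1 + d * a3) (b * a2 + d * a4)
                    (b * b1 + d * b3) (b * b2 + d * b4) *m g
              = g *m mx22 a3 a4 b3 b4.
  rewrite !mul_mx22; congr mx22; [comb e3 | comb e4 | comb f3 | comb f4].
by rewrite !mxtrace_mx22 => h; comb h.
Qed.

Lemma algDer_opp a1 a2 a3 a4 b1 b2 b3 b4 a b c d :
  algDer (mx24 a1 a2 a3 a4 b1 b2 b3 b4) (mx22 a b c d) ->
  algDer (mx24 a1 a3 a2 a4 b1 b3 b2 b4) (mx22 a b c d).
Proof.
move=> /algDer_mx22[[e1 e2 e3 e4] [f1 f2 f3 f4]].
apply/algDer_mx22; split; split; [comb e1 | comb e3 | comb e2 | comb e4
  | comb f1 | comb f3 | comb f2 | comb f4].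
Qed.

(** Here left multiplication by D e_i is the commutator of D with left
    multiplication by e_i, which is traceless; the sum of two of the eight
    equations expresses just this. *)
Lemma algDer_trace a1 a2 a3 a4 b1 b2 b3 b4 a b c d :
  algDer (mx24 a1 a2 a3 a4 b1 b2 b3 b4) (mx22 a b c d) ->
  a * (a1 + b2) + c * (a3 + b4) = 0 /\
  b * (a1 + b2) + d * (a3 + b4) = 0.
Proof.
move=> /algDer_mx22[[e1 e2 e3 e4] [f1 f2 f3 f4]].
split; [comb (e1 +e f2) | comb (e3 +e f4)].
Qed.

Lemma algAut_1 a1 a2 a3 a4 b1 b2 b3 b4 :
  algAut (mx24 a1 a2 a3 a4 b1 b2 b3 b4) (1%:M : 'M[F]_2).
Proof.
rewrite mx22_1; apply/algAut_mx22; split; last by split; char2_ring.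
  by rewrite mul1r mul0r addr0 oner_eq0.
by split; char2_ring.
Qed.

Lemma algDer_0 (A : 'M[F]_(2, 2 * 2)) : algDer A 0.
Proof. by rewrite /algDer /= mul0mx tens0mx tensmx0 addr0 mulmx0. Qed.

(** The first coordinate form is the left trace form
    (a1 + b2, a3 + b4), or the right one (a1 + b3, a2 + b4). *)
Definition unit_trace a1 a2 a3 a4 b1 b2 b3 b4 :=
  a1 + b2 = 1 /\ a3 + b4 = 0 \/ a1 + b3 = 1 /\ a2 + b4 = 0 :> F.

Lemma algAut_unit_trace a1 a2 a3 a4 b1 b2 b3 b4 (g : 'M[F]_2) :
  unit_trace a1 a2 a3 a4 b1 b2 b3 b4 ->
  algAut (mx24 a1 a2 a3 a4 b1 b2 b3 b4) g ->
  exists c d, d != 0 /\ g = mx22 1 0 c d.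
Proof.
move=> tr1; have [a [b [c [d ->]]]] := mx22_eta g => Ag.
have [a_1 b_0] : a = 1 /\ b = 0.
  have [l1 l2] := algAut_trace Ag; have [r1 r2] := algAut_trace (algAut_opp Ag).
  by case: tr1 => -[t1 t2]; rewrite ?t1 ?t2 in l1 l2 r1 r2; split;
    [comb l1 | comb l2 | comb r1 | comb r2].
exists c, d; rewrite a_1 b_0; split=> //.
move/algAut_mx22: Ag => [Hd _ _]; apply: contraNneq Hd => ->.
by apply/eqP; rewrite b_0; char2_ring.
Qed.

Lemma algDer_unit_trace a1 a2 a3 a4 b1 b2 b3 b4 (D : 'M[F]_2) :
  unit_trace a1 a2 a3 a4 b1 b2 b3 b4 ->
  algDer (mx24 a1 a2 a3 a4 b1 b2 b3 b4) D ->
  exists c d, D = mx22 0 0 c d.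
Proof.
move=> tr1; have [a [b [c [d ->]]]] := mx22_eta D => AD.
have [a_0 b_0] : a = 0 /\ b = 0.
  have [l1 l2] := algDer_trace AD; have [r1 r2] := algDer_trace (algDer_opp AD).
  by case: tr1 => -[t1 t2]; rewrite ?t1 ?t2 in l1 l2 r1 r2; split;
    [comb l1 | comb l2 | comb r1 | comb r2].
by exists c, d; rewrite a_0 b_0.
Qed.

(** * The algebras whose trace forms are independent: A1 *)

Lemma algAut_A1_2 a1 a2 a4 b1 : algAut (A1_2 a1 a2 a4 b1) = [set 1%:M].
Proof.
apply/seteqP; split=> [g | g ->]; last exact: algAut_1.
have [a [b [c [d ->]]]] := mx22_eta g => Ag.
have [l1 l2] := algAut_trace Ag.
have [r1 r2] := algAut_trace (algAut_opp Ag).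
by rewrite /= mx22_1; congr mx22; [comb r1 | comb r2 | comb l1 | comb l2].
Qed.

Lemma algDer_A1_2 a1 a2 a4 b1 : algDer (A1_2 a1 a2 a4 b1) = [set 0].
Proof.
apply/seteqP; split=> [D | D ->]; last exact: algDer_0.
have [a [b [c [d ->]]]] := mx22_eta D => AD.
have [l1 l2] := algDer_trace AD.
have [r1 r2] := algDer_trace (algDer_opp AD).
by rewrite /= mx22_0; congr mx22; [comb r1 | comb r2 | comb l1 | comb l2].
Qed.

(** * The family of A2, A3, A5 and A6 *)

(** With first row (1 0), the e2-coordinate of g (e1 e1) = (g e1)^2 is the
    equation for s = a1 + b2 + b3, and g (e2 e2) = (g e2)^2 gives the two
    equations in a4; they imply the others. *)
Lemma algAut_mixed a1 a4 b1 b2 b3 (g : 'M[F]_2) :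
  unit_trace a1 0 0 a4 b1 b2 b3 0 ->
  algAut (mx24 a1 0 0 a4 b1 b2 b3 0) g <->
  exists c d, [/\ d != 0, c * a4 = 0, d ^+ 2 * a4 = a4,
    c * (a1 + b2 + b3) = (1 + d) * b1 & g = mx22 1 0 c d].
Proof.
move=> tr1; split=> [Ag | [c [d [d0 ca4 da4 cb ->]]]].
  have [c [d [d0 g_cd]]] := algAut_unit_trace tr1 Ag.
  move: Ag; rewrite g_cd => /algAut_mx22[_ [e1 e2 e3 e4] [f1 f2 f3 f4]].
  by exists c, d; split=> //; [comb f4 | comb e4 | comb f1].
apply/algAut_mx22; split; first by rewrite mul1r mul0r addr0.
  split; [comb (c *e ca4) | comb (d *e ca4) | comb (d *e ca4) | comb da4].
split; [comb cb | char2_ring | char2_ring | comb ca4].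
Qed.

Lemma algDer_mixed a1 a4 b1 b2 b3 (D : 'M[F]_2) :
  unit_trace a1 0 0 a4 b1 b2 b3 0 ->
  algDer (mx24 a1 0 0 a4 b1 b2 b3 0) D <->
  exists c d, [/\ c * a4 = 0, c * (a1 + b2 + b3) = d * b1
    & D = mx22 0 0 c d].
Proof.
move=> tr1; split=> [AD | [c [d [ca4 cb ->]]]].
  have [c [d D_cd]] := algDer_unit_trace tr1 AD.
  move: AD; rewrite D_cd => /algDer_mx22[[e1 e2 e3 e4] [f1 f2 f3 f4]].
  by exists c, d; split=> //; [comb f4 | comb f1].
apply/algDer_mx22; split; split; [char2_ring | comb ca4 | comb ca4
  | char2_ring | comb cb | char2_ring | char2_ring | comb ca4].
Qed.

Lemma algAut_mixed_trivial a1 a4 b2 b3 :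
  unit_trace a1 0 0 a4 1 b2 b3 0 -> a4 != 0 ->
  algAut (mx24 a1 0 0 a4 1 b2 b3 0) = [set 1%:M].
Proof.
move=> tr1 a40; apply/seteqP; split=> [g | g ->]; last exact: algAut_1.
case/(algAut_mixed _ tr1) => c [d [_ /eqP + _ + ->]].
rewrite mulf_eq0 (negPf a40) orbF => /eqP -> cb /=.
by rewrite mx22_1; congr mx22; comb cb.
Qed.

Lemma algDer_mixed_trivial a1 a4 b2 b3 :
  unit_trace a1 0 0 a4 1 b2 b3 0 -> a4 != 0 ->
  algDer (mx24 a1 0 0 a4 1 b2 b3 0) = [set 0].
Proof.
move=> tr1 a40; apply/seteqP; split=> [D | D ->]; last exact: algDer_0.
case/(algDer_mixed _ tr1) => c [d [/eqP + + ->]].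
rewrite mulf_eq0 (negPf a40) orbF => /eqP -> cb /=.
by rewrite mx22_0; congr mx22; comb cb.
Qed.

Lemma algAut_mixed_shear a1 b2 b3 :
  unit_trace a1 0 0 0 1 b2 b3 0 -> a1 + b2 + b3 = 0 ->
  algAut (mx24 a1 0 0 0 1 b2 b3 0) = [set g | exists c, g = mx22 1 0 c 1].
Proof.
move=> tr1 s0; apply/seteqP; split=> g /=.
  case/(algAut_mixed _ tr1) => c [d [_ _ _ + ->]]; rewrite s0 => cb.
  by exists c; congr mx22; comb cb.
case=> c ->; apply/(algAut_mixed _ tr1); exists c, 1; rewrite s0.
by split; rewrite ?oner_eq0 //; char2_ring.
Qed.

Lemma algDer_mixed_shear a1 b2 b3 :
  unit_trace a1 0 0 0 1 b2 b3 0 -> a1 + b2 + b3 = 0 ->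
  algDer (mx24 a1 0 0 0 1 b2 b3 0) = [set D | exists c, D = mx22 0 0 c 0].
Proof.
move=> tr1 s0; apply/seteqP; split=> D /=.
  case/(algDer_mixed _ tr1) => c [d [_ + ->]]; rewrite s0 => cb.
  by exists c; congr mx22; comb cb.
case=> c ->; apply/(algDer_mixed _ tr1); exists c, 0; rewrite s0.
by split=> //; char2_ring.
Qed.

Lemma algAut_mixed0_trivial a1 a4 b2 b3 :
  unit_trace a1 0 0 a4 0 b2 b3 0 -> a4 != 0 ->
  algAut (mx24 a1 0 0 a4 0 b2 b3 0) = [set 1%:M].
Proof.
move=> tr1 a40; apply/seteqP; split=> [g | g ->]; last exact: algAut_1.
case/(algAut_mixed _ tr1) => c [d [_ /eqP + da4 _ ->]].
rewrite mulf_eq0 (negPf a40) orbF => /eqP -> /=.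
rewrite mx22_1; congr mx22; apply: char2_sqr_inj; apply: (mulIf a40).
comb da4.
Qed.

Lemma algAut_mixed0_diag a1 b2 b3 :
  unit_trace a1 0 0 0 0 b2 b3 0 -> a1 + b2 + b3 != 0 ->
  algAut (mx24 a1 0 0 0 0 b2 b3 0) =
    [set g | exists d, d != 0 /\ g = mx22 1 0 0 d].
Proof.
move=> tr1 s0; apply/seteqP; split=> g /=.
  case/(algAut_mixed _ tr1) => c [d [d0 _ _ + ->]].
  rewrite mulr0 => /eqP; rewrite mulf_eq0 (negPf s0) orbF => /eqP ->.
  by exists d.
case=> d [d0 ->]; apply/(algAut_mixed _ tr1); exists 0, d.
by split=> //; char2_ring.
Qed.

Lemma algAut_mixed0_triangular a1 b2 b3 :
  unit_trace a1 0 0 0 0 b2 b3 0 -> a1 + b2 + b3 = 0 ->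
  algAut (mx24 a1 0 0 0 0 b2 b3 0) =
    [set g | exists c d, d != 0 /\ g = mx22 1 0 c d].
Proof.
move=> tr1 s0; apply/seteqP; split=> g /=.
  by case/(algAut_mixed _ tr1) => c [d [d0 _ _ _ ->]]; exists c, d.
case=> c [d [d0 ->]]; apply/(algAut_mixed _ tr1); exists c, d; rewrite s0.
by split=> //; char2_ring.
Qed.

Lemma algDer_mixed0_diag a1 a4 b2 b3 :
  unit_trace a1 0 0 a4 0 b2 b3 0 -> a4 != 0 \/ a1 + b2 + b3 != 0 ->
  algDer (mx24 a1 0 0 a4 0 b2 b3 0) = [set D | exists d, D = mx22 0 0 0 d].
Proof.
move=> tr1 a4s; apply/seteqP; split=> D /=.
  case/(algDer_mixed _ tr1) => c [d [ca4 + ->]]; rewrite mulr0 => cs.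
  exists d; congr mx22; apply/eqP.
  case: a4s => n0; [move/eqP: ca4 | move/eqP: cs];
    by rewrite mulf_eq0 (negPf n0) orbF.
case=> d ->; apply/(algDer_mixed _ tr1); exists 0, d.
by split=> //; char2_ring.
Qed.

Lemma algDer_mixed0_triangular a1 b2 b3 :
  unit_trace a1 0 0 0 0 b2 b3 0 -> a1 + b2 + b3 = 0 ->
  algDer (mx24 a1 0 0 0 0 b2 b3 0) =
    [set D | exists c d, D = mx22 0 0 c d].
Proof.
move=> tr1 s0; apply/seteqP; split=> D /=.
  by case/(algDer_mixed _ tr1) => c [d [_ _ ->]]; exists c, d.
case=> c [d ->]; apply/(algDer_mixed _ tr1); exists c, d; rewrite s0.
by split=> //; char2_ring.
Qed.

(** * The family of A4 and A7 *)

(** The products e1 e2 and e2 e1 have e1-coordinate 1, which forces d = 1;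
    only the e2-coordinate of g (e1 e1) = (g e1)^2 remains. *)
Lemma algAut_idem a1 b1 b2 b3 (g : 'M[F]_2) :
  unit_trace a1 1 1 0 b1 b2 b3 1 ->
  algAut (mx24 a1 1 1 0 b1 b2 b3 1) g <->
  exists c, c * (c + (a1 + b2 + b3)) = 0 /\ g = mx22 1 0 c 1.
Proof.
move=> tr1; split=> [Ag | [c [cb ->]]].
  have [c [d [d0 g_cd]]] := algAut_unit_trace tr1 Ag.
  move: Ag; rewrite g_cd => /algAut_mx22[_ [e1 e2 e3 e4] [f1 f2 f3 f4]].
  have d_1 : d = 1 by comb e2.
  by exists c; rewrite {}d_1 in f1 *; split=> //; comb f1.
apply/algAut_mx22; split; first by rewrite !mul1r mul0r addr0 oner_eq0.
  by split; char2_ring.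
split; [comb cb | char2_ring | char2_ring | char2_ring].
Qed.

Lemma algDer_idem a1 b1 b2 b3 (D : 'M[F]_2) :
  unit_trace a1 1 1 0 b1 b2 b3 1 ->
  algDer (mx24 a1 1 1 0 b1 b2 b3 1) D <->
  exists c, c * (a1 + b2 + b3) = 0 /\ D = mx22 0 0 c 0.
Proof.
move=> tr1; split=> [AD | [c [cb ->]]].
  have [c [d D_cd]] := algDer_unit_trace tr1 AD.
  move: AD; rewrite D_cd => /algDer_mx22[[e1 e2 e3 e4] [f1 f2 f3 f4]].
  have d_0 : d = 0 by comb e2.
  by exists c; rewrite {}d_0 in f1 *; split=> //; comb f1.
apply/algDer_mx22; split; split; [char2_ring | char2_ring | char2_ring
  | char2_ring | comb cb | char2_ring | char2_ring | char2_ring].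
Qed.

Lemma algAut_idem_pair a1 b1 b2 b3 :
  unit_trace a1 1 1 0 b1 b2 b3 1 ->
  algAut (mx24 a1 1 1 0 b1 b2 b3 1) =
    [set 1%:M; mx22 1 0 (a1 + b2 + b3) 1].
Proof.
move=> tr1; apply/seteqP; split=> g /=.
  case/(algAut_idem _ tr1) => c [/eqP + ->].
  rewrite mulf_eq0 char2_add_eq0 => /orP[] /eqP ->; last by right.
  by left; rewrite mx22_1.
by case=> ->; [exact: algAut_1 |];
   apply/(algAut_idem _ tr1); eexists; split=> //; char2_ring.
Qed.

Lemma algDer_idem_trivial a1 b1 b2 b3 :
  unit_trace a1 1 1 0 b1 b2 b3 1 -> a1 + b2 + b3 != 0 ->
  algDer (mx24 a1 1 1 0 b1 b2 b3 1) = [set 0].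
Proof.
move=> tr1 s0; apply/seteqP; split=> [D | D ->]; last exact: algDer_0.
case/(algDer_idem _ tr1) => c [/eqP + ->].
by rewrite mulf_eq0 (negPf s0) orbF => /eqP -> /=; rewrite mx22_0.
Qed.

Lemma algDer_idem_shear a1 b1 b2 b3 :
  unit_trace a1 1 1 0 b1 b2 b3 1 -> a1 + b2 + b3 = 0 ->
  algDer (mx24 a1 1 1 0 b1 b2 b3 1) = [set D | exists c, D = mx22 0 0 c 0].
Proof.
move=> tr1 s0; apply/seteqP; split=> D /=.
  by case/(algDer_idem _ tr1) => c [_ ->]; exists c.
by case=> c ->; apply/(algDer_idem _ tr1); exists c; rewrite s0 mulr0.
Qed.

(** * Trace forms and shear coefficients of A2 to A7 *)

Lemma unit_trace_A2_A3 a1 a4 b1 b2 : unit_trace a1 0 0 a4 b1 b2 (1 + a1) 0.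
Proof. right; split; char2_ring. Qed.

Lemma unit_trace_A5_A6 a1 a4 b1 : unit_trace a1 0 0 a4 b1 (1 + a1) a1 0.
Proof. left; split; char2_ring. Qed.

Lemma unit_trace_A4 a1 b1 b2 : unit_trace a1 1 1 0 b1 b2 (1 + a1) 1.
Proof. right; split; char2_ring. Qed.

Lemma unit_trace_A7 a1 b1 : unit_trace a1 1 1 0 b1 (1 + a1) a1 1.
Proof. left; split; char2_ring. Qed.

(** The value of a1 + b2 + b3, which decides whether shears along e2 survive. *)
Lemma shear_coef_A2_A3_A4 x y : x + y + (1 + x) = 1 + y.
Proof. char2_ring. Qed.

Lemma shear_coef_A5_A6_A7 x : x + (1 + x) + x = x + 1.
Proof. char2_ring. Qed.

(** * The algebra A8 *)

Lemma algAut_A8_2P b1 a b c d :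
  algAut (A8_2 b1) (mx22 a b c d) <->
  [/\ a * d + b * c != 0,
    [/\ b1 * b = c ^+ 2, b1 * d = a ^+ 2 * b1 + c ^+ 2 & b = d ^+ 2 + a]
  & [/\ a = a * d + b * c + c * d, c = a * b * b1 + c * d
      & c + d = b ^+ 2 * b1 + d ^+ 2]].
Proof.
split=> [/algAut_mx22[Hd [e1 e2 e3 e4] [f1 f2 f3 f4]] |
    [Hd [e1 f1 e4] [e2 f2 f4]]].
  by split=> //; split; [comb e1 | comb f1 | comb e4 | comb e2 | comb f2
    | comb f4].
apply/algAut_mx22; split=> //; split;
  [comb e1 | comb e2 | comb e2 | comb e4 | comb f1 | comb f2 | comb f2
  | comb f4].
Qed.

Lemma algAut_A8_2 b1 : b1 != 0 ->
  algAut (A8_2 b1) =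
    [set 1%:M]
    `|` [set g | exists d, [/\ d ^+ 2 + d + 1 != 0,
           b1 = 1 / (d ^+ 2 + d + 1) & g = mx22 (1 + d) (1 + d + d ^+ 2) 1 d]]
    `|` [set g | exists d, [/\ d != 0, b1 = (1 + d) / d ^+ 3
           & g = mx22 d (d + d ^+ 2) ((1 + d) / d) d]].
Proof.
move=> b1n0; apply/seteqP; split=> g /=.
  have [a [b [c [d ->]]]] := mx22_eta g.
  case/algAut_A8_2P => Hd [e1 e2 b_ad] [e3 e4 e5].
  have e6 : d = a ^+ 2 + b by apply: (mulfI b1n0); comb (e1 +e e2).
  have /eqP : (a + d) * (a + d + 1) = 0 by comb (e6 +e b_ad).
  rewrite mulf_eq0 -addrA !char2_add_eq0 => /orP[] /eqP a_d.
    (* The case a = d gives the identity (d = 1) and the second family. *)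
    subst a; have {}b_ad : b = d + d ^+ 2 by comb b_ad.
    subst b; have d0 : d != 0.
      by apply: contraNneq Hd => ->; apply/eqP; char2_ring.
    have cd : c * d = 1 + d by apply: (mulfI d0); comb e3.
    have c_d : c = (1 + d) / d by rewrite -cd mulfK.
    have [d1 | d1] := eqVneq d 1.
      left; left; rewrite mx22_1 c_d d1 divr1.
      by congr mx22; char2_ring.
    right; exists d; split=> //; last by rewrite c_d.
    have d1' : 1 + d != 0 by rewrite char2_add_eq0 eq_sym.
    apply: (canRL (mulfK (expf_neq0 3 d0))); apply: (mulfI d1').
    comb (d ^+ 2 *e e1 +e (c * d + 1 + d) *e cd).
  (* The case a = d + 1 gives the first family. *)
  subst a; have {}b_ad : b = 1 + d + d ^+ 2 by comb b_ad.
  subst b; have c1 : c = 1.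
    have /eqP : (c + 1) * (d + 1) ^+ 2 = 0 by comb e3.
    rewrite mulf_eq0 sqrf_eq0 !char2_add_eq0 => /orP[/eqP // | /eqP d1].
    (* At d = 1 the matrix is (0 1; c 1), and c = b1 is a nonzero idempotent. *)
    subst d; have c_b1 : b1 = c by comb e5.
    have c0 : c != 0 by rewrite -c_b1.
    by apply: (mulfI c0); rewrite c_b1 in e1; comb e1.
  left; right; exists d; subst c.
  have e7 : b1 * (d ^+ 2 + d + 1) = 1 by comb e1.
  have n0 : d ^+ 2 + d + 1 != 0.
    by apply: contra_eq_neq e7 => ->; rewrite mulr0 eq_sym oner_eq0.
  split=> //; first by apply: (canRL (mulfK n0)).
  by congr mx22; char2_ring.
case=> [[-> | [d [n0 b1_d ->]]] | [d [d0 b1_d ->]]]; first exact: algAut_1.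
  have e : b1 * (d ^+ 2 + d + 1) = 1 by rewrite b1_d divfK.
  apply/algAut_A8_2P; split.
    by rewrite (_ : _ + _ = 1) ?oner_eq0 //; char2_ring.
  split; [comb e | comb e | char2_ring].
  split; [char2_ring | comb ((1 + d) *e e) | comb ((1 + d + d ^+ 2) *e e)].
set c := (1 + d) / d; have cd : c * d = 1 + d by rewrite divfK.
have c_b1 : c = b1 * d ^+ 2.
  apply: (mulIf d0); rewrite cd -mulrA -exprSr b1_d divfK //.
  exact: expf_neq0.
have b1_c : b1 * (d + d ^+ 2) = c ^+ 2.
  by comb (c *e c_b1 +e (b1 * d) *e cd).
apply/algAut_A8_2P; split.
  by rewrite (_ : _ + _ = 1) ?oner_eq0 //; comb ((1 + d) *e cd).
all: split.
- exact: b1_c.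
- by comb b1_c.
- by char2_ring.
- by comb (d *e cd).
- by comb ((1 + d) *e c_b1).
- by comb ((1 + d ^+ 2) *e c_b1 +e d *e cd).
Qed.

Lemma algDer_A8_2P b1 a b c d :
  algDer (A8_2 b1) (mx22 a b c d) <->
  [/\ b1 * b = 0, b1 * d = 0, a = b & c = d].
Proof.
split=> [/algDer_mx22[[e1 e2 e3 e4] [f1 f2 f3 f4]] | [b1b b1d -> ->]].
  by split; [comb e1 | comb f1 | comb e4 | comb f4].
apply/algDer_mx22; split; split; [comb b1b | char2_ring | char2_ring
  | char2_ring | comb b1d | comb b1b | comb b1b | char2_ring].
Qed.

Lemma algDer_A8_2 b1 : b1 != 0 -> algDer (A8_2 b1) = [set 0].
Proof.
move=> b1n0; apply/seteqP; split=> [D | D ->]; last exact: algDer_0.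
have [a [b [c [d ->]]]] := mx22_eta D.
case/algDer_A8_2P => /eqP + /eqP; rewrite !mulf_eq0 (negPf b1n0) /=.
by move=> /eqP-> /eqP-> -> ->; rewrite -mx22_0.
Qed.

Lemma algAut_A8_2_0 :
  algAut (A8_2 0) = [set g | exists b, 1 + b != 0 /\ g = mx22 (1 + b) b 0 1].
Proof.
apply/seteqP; split=> g /=.
  have [a [b [c [d ->]]]] := mx22_eta g.
  case/algAut_A8_2P => Hd [e1 e2 b_ad] [e3 e4 e5].
  have c0 : c = 0 by apply/eqP; rewrite -sqrf_eq0 -e1 mul0r.
  subst c; have a0 : a != 0.
    by apply: contraNneq Hd => ->; apply/eqP; char2_ring.
  have d1 : d = 1 by apply: (mulfI a0); comb e3.
  have a_b : a = 1 + b by rewrite d1 in b_ad; comb b_ad.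
  by exists b; rewrite -a_b d1.
case=> b [n0 ->]; apply/algAut_A8_2P; split; first by rewrite mulr1 mulr0 addr0.
  by split; char2_ring.
by split; char2_ring.
Qed.

Lemma algDer_A8_2_0 : algDer (A8_2 0) = [set D | exists a c, D = mx22 a a c c].
Proof.
apply/seteqP; split=> D /=.
  have [a [b [c [d ->]]]] := mx22_eta D.
  by case/algDer_A8_2P => _ _ -> ->; exists b, d.
by case=> a [c ->]; apply/algDer_A8_2P; rewrite !mul0r.
Qed.

(** * The algebra A9 *)

Lemma algAut_A9_2P b1 a b c d :
  algAut (A9_2 b1) (mx22 a b c d) <->
  [/\ a * d + b * c != 0,
    [/\ b1 * b = c ^+ 2, b1 * d = a ^+ 2 * b1, a = d ^+ 2 & c = b ^+ 2 * b1]
  & c * d = 0 /\ a * b * b1 = 0].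
Proof.
split=> [/algAut_mx22[Hd [e1 e2 e3 e4] [f1 f2 f3 f4]] |
    [Hd [e1 f1 e4 f4] [e2 f2]]].
  by split=> //; split; [comb e1 | comb f1 | comb e4 | comb f4 | comb e2
    | comb f2].
apply/algAut_mx22; split=> //; split;
  [comb e1 | comb e2 | comb e2 | comb e4 | comb f1 | comb f2 | comb f2
  | comb f4].
Qed.

Lemma algAut_A9_2 b1 : b1 != 0 ->
  algAut (A9_2 b1) =
    [set g | exists d, d ^+ 3 = 1 /\ g = mx22 (d ^+ 2) 0 0 d]
    `|` [set g | exists b, [/\ b != 0, b1 = 1 / b ^+ 3
           & g = mx22 0 b (1 / b) 0]].
Proof.
move=> b1n0; apply/seteqP; split=> g /=.
  have [a [b [c [d ->]]]] := mx22_eta g.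
  case/algAut_A9_2P => Hd [e1 f1 a_d c_b] [/eqP + _]; subst a.
  rewrite mulf_eq0 => /orP[] /eqP z0.
    (* c = 0: the diagonal automorphisms. *)
    have b0 : b = 0 by apply: (mulfI b1n0); rewrite e1 z0; char2_ring.
    have d0 : d != 0.
      by apply: contraNneq Hd => ->; apply/eqP; rewrite b0; char2_ring.
    left; exists d; rewrite z0 b0; split=> //.
    by apply: (mulfI d0); apply: (mulfI b1n0); comb f1.
  (* d = 0: the antidiagonal ones. *)
  have b0 : b != 0.
    by apply: contraNneq Hd => ->; apply/eqP; rewrite z0; char2_ring.
  have b1_b : b1 * b ^+ 3 = 1.
    apply: (mulfI b0); apply: (mulfI b1n0); rewrite c_b in e1; comb e1.
  right; exists b; split=> //; first exact: (canRL (mulfK (expf_neq0 3 b0))).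
  have -> : c = 1 / b by apply: (canRL (mulfK b0)); rewrite c_b; comb b1_b.
  by rewrite z0; congr mx22; char2_ring.
case=> [[d [d3 ->]] | [b [b0 b1_b ->]]].
  have d0 : d != 0.
    by apply: contra_eq_neq d3 => ->; rewrite expr0n eq_sym oner_eq0.
  apply/algAut_A9_2P; split; first by rewrite mulr0 addr0 mulf_neq0 ?expf_neq0.
    by split; [char2_ring | comb ((b1 * d) *e d3) | char2_ring | char2_ring].
  by split; char2_ring.
have {}b1_b : b1 * b ^+ 3 = 1 by rewrite b1_b divfK ?expf_neq0.
set c := 1 / b; have cb : c * b = 1 by rewrite divfK.
have c_b : c = b ^+ 2 * b1 by apply: (mulIf b0); rewrite cb; comb b1_b.
apply/algAut_A9_2P; split.
- by rewrite mulr0 add0r mulrC cb oner_eq0.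
- split; [comb (c *e c_b +e (b1 * b) *e cb) | char2_ring | char2_ring
    | exact: c_b].
- by split; char2_ring.
Qed.

Lemma algDer_A9_2P b1 a b c d :
  algDer (A9_2 b1) (mx22 a b c d) <->
  [/\ b1 * b = 0, b1 * d = 0, a = 0 & c = 0].
Proof.
split=> [/algDer_mx22[[e1 e2 e3 e4] [f1 f2 f3 f4]] | [b1b b1d -> ->]].
  by split; [comb e1 | comb f1 | comb e4 | comb f4].
apply/algDer_mx22; split; split; [comb b1b | char2_ring | char2_ring
  | char2_ring | comb b1d | comb b1b | comb b1b | char2_ring].
Qed.

Lemma algDer_A9_2 b1 : b1 != 0 -> algDer (A9_2 b1) = [set 0].
Proof.
move=> b1n0; apply/seteqP; split=> [D | D ->]; last exact: algDer_0.
have [a [b [c [d ->]]]] := mx22_eta D.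
case/algDer_A9_2P => /eqP + /eqP; rewrite !mulf_eq0 (negPf b1n0) /=.
by move=> /eqP-> /eqP-> -> ->; rewrite -mx22_0.
Qed.

Lemma algAut_A9_2_0 :
  algAut (A9_2 0) = [set g | exists b d, d != 0 /\ g = mx22 (d ^+ 2) b 0 d].
Proof.
apply/seteqP; split=> g /=.
  have [a [b [c [d ->]]]] := mx22_eta g.
  case/algAut_A9_2P => Hd [_ _ -> c_b] _.
  have c0 : c = 0 by rewrite c_b; char2_ring.
  exists b, d; rewrite c0; split=> //.
  by apply: contraNneq Hd => ->; apply/eqP; rewrite c0; char2_ring.
case=> b [d [d0 ->]]; apply/algAut_A9_2P; split.
- by rewrite mulr0 addr0 mulf_neq0 ?expf_neq0.
- by split; char2_ring.
- by split; char2_ring.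
Qed.

Lemma algDer_A9_2_0 : algDer (A9_2 0) = [set D | exists b d, D = mx22 0 b 0 d].
Proof.
apply/seteqP; split=> D /=.
  have [a [b [c [d ->]]]] := mx22_eta D.
  by case/algDer_A9_2P => _ _ -> ->; exists b, d.
by case=> b [d ->]; apply/algDer_A9_2P; rewrite !mul0r.
Qed.

(** * The algebra A10 *)

Lemma algAut_A10_2P b1 a b c d :
  algAut (A10_2 b1) (mx22 a b c d) <->
  [/\ a * d + b * c != 0,
    [/\ a + b * b1 = a ^+ 2, a + b = a * b + a * d + b * c & b = b ^+ 2]
  & [/\ c + d * b1 = a ^+ 2 * b1 + c ^+ 2,
        c + d = a * b * b1 + a * d + b * c + c * d
      & d = b ^+ 2 * b1 + d ^+ 2]].
Proof.
split=> [/algAut_mx22[Hd [e1 e2 e3 e4] [f1 f2 f3 f4]] |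
    [Hd [e1 e2 e4] [f1 f2 f4]]].
  by split=> //; split; [comb e1 | comb e2 | comb e4 | comb f1 | comb f2
    | comb f4].
apply/algAut_mx22; split=> //; split;
  [comb e1 | comb e2 | comb e2 | comb e4 | comb f1 | comb f2 | comb f2
  | comb f4].
Qed.

Lemma algAut_A10_2 b1 :
  algAut (A10_2 b1) =
    [set 1%:M; mx22 1 0 1 1]
    `|` [set g | exists d : F, b1 = d + d ^+ 2 /\
           [\/ g = mx22 d 1 (1 + d ^+ 2) d,
               g = mx22 d 1 (1 + d + d ^+ 2) (1 + d),
               g = mx22 (1 + d) 1 (1 + d + d ^+ 2) d
             | g = mx22 (1 + d) 1 (d ^+ 2) (1 + d)]].
Proof.
apply/seteqP; split=> g /=.
  have [a [b [c [d ->]]]] := mx22_eta g.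
  case/algAut_A10_2P => Hd [e1 e2 e4] [f1 f2 f4].
  have /eqP : b * (b + 1) = 0 by comb e4.
  rewrite mulf_eq0 char2_add_eq0 => /orP[] /eqP b_01; subst b.
    have [a0 d0] : a != 0 /\ d != 0.
      by split; apply: contraNneq Hd => ->; apply/eqP; char2_ring.
    have a1 : a = 1 by apply: (mulfI a0); comb e1.
    have d1 : d = 1 by apply: (mulfI d0); comb f4.
    subst a d; have /eqP : c * (c + 1) = 0 by comb f1.
    rewrite mulf_eq0 char2_add_eq0 => /orP[] /eqP ->; left; last by right.
    by left; rewrite mx22_1.
  have c_ad : c = 1 + a * d by comb e2.
  have b1_a : b1 = a + a ^+ 2 by comb e1.
  (* a and d are both roots of x + x ^ 2 = b1. *)
  have /eqP : (d + a) * (d + (a + 1)) = 0 by comb (f4 +e b1_a).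
  rewrite mulf_eq0 !char2_add_eq0 => d_a; right; exists a; split=> //.
  case/orP: d_a => /eqP d_a; subst d; [constructor 1 | constructor 2];
    by rewrite c_ad; congr mx22; char2_ring.
case=> [[-> | ->] | [d [-> g_d]]]; first exact: algAut_1.
  apply/algAut_A10_2P; split; first by rewrite mul1r mul0r addr0 oner_eq0.
    by split; char2_ring.
  by split; char2_ring.
(* All four matrices have determinant 1. *)
have det1 a b c' d' : a * d' + b * c' = 1 -> a * d' + b * c' != 0.
  by move=> ->; exact: oner_neq0.
by case: g_d => ->; apply/algAut_A10_2P;
  (split; [apply: det1 | split | split]); char2_ring.
Qed.

Lemma algDer_A10_2 b1 : algDer (A10_2 b1) = [set 0].
Proof.
apply/seteqP; split=> [D | D ->]; last exact: algDer_0.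
have [a [b [c [d ->]]]] := mx22_eta D.
case/algDer_mx22 => -[e1 _ _ e4] [f1 _ _ f4].
rewrite /= mx22_0; congr mx22; [comb (e1 +e b1 *e e4) | comb e4
  | comb (f1 +e b1 *e f4) | comb f4].
Qed.

(** * The algebra A11 *)

Lemma algAut_A11_2 b1 :
  algAut (A11_2 b1) =
    [set g | exists a c, [/\ a != 0, c ^+ 2 = (1 + a ^+ 2) * b1
       & g = mx22 a 0 c 1]].
Proof.
apply/seteqP; split=> g /=.
  have [a [b [c [d ->]]]] := mx22_eta g.
  case/algAut_mx22 => Hd [e1 e2 e3 e4] [f1 f2 f3 f4].
  have b0 : b = 0 by comb e4.
  subst b; have [a0 d0] : a != 0 /\ d != 0.
    by split; apply: contraNneq Hd => ->; apply/eqP; char2_ring.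
  have d1 : d = 1 by apply: (mulfI d0); comb f4.
  by subst d; exists a, c; split=> //; comb f1.
case=> a [c [a0 c2 ->]]; apply/algAut_mx22; split.
- by rewrite mulr1 mul0r addr0.
- by split; char2_ring.
- by split; [comb c2 | char2_ring | char2_ring | char2_ring].
Qed.

Lemma algDer_A11_2 b1 :
  algDer (A11_2 b1) = [set D | exists a c, D = mx22 a 0 c 0].
Proof.
apply/seteqP; split=> D /=.
  have [a [b [c [d ->]]]] := mx22_eta D.
  case/algDer_mx22 => -[_ _ _ e4] [_ _ _ f4].
  by exists a, c; congr mx22; [comb e4 | comb f4].
by case=> a [c ->]; apply/algDer_mx22; split; split; char2_ring.
Qed.

End CharTwo.

(** * The classification of automorphisms and derivations *)

Theorem theorem3p2 (F : fieldType) (charF2 : 2%N \in [pchar F]) :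
  (* 1 *)
  (forall a1 a2 a4 b1 : F,
     algAut (A1_2 a1 a2 a4 b1) = [set 1%:M] /\
     algDer (A1_2 a1 a2 a4 b1) = [set 0]) /\
  (* 2 *)
  ((forall a1 a4 b2 : F, A2_2_admissible a1 a4 b2 ->
      (a4 != 0 -> algAut (A2_2 a1 a4 b2) = [set 1%:M]) /\
      (a4 != 0 \/ b2 != 1 -> algDer (A2_2 a1 a4 b2) = [set 0])) /\
   (forall a1 : F,
      algAut (A2_2 a1 0 1) = [set g | exists c : F, g = mx22 1 0 c 1] /\
      algDer (A2_2 a1 0 1) = [set D | exists c : F, D = mx22 0 0 c 0])) /\
  (* 3 *)
  ((forall a1 a4 b2 : F, a4 != 0 ->
      algAut (A3_2 a1 a4 b2) = [set mx22 1 0 0 1; mx22 1 0 0 (-1)]) /\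
   (forall a1 b2 : F, b2 != 1 ->
      algAut (A3_2 a1 0 b2) =
        [set g | exists d : F, d != 0 /\ g = mx22 1 0 0 d]) /\
   (forall a1 a4 b2 : F, a4 != 0 \/ b2 != 1 ->
      algDer (A3_2 a1 a4 b2) = [set D | exists d : F, D = mx22 0 0 0 d]) /\
   (forall a1 : F,
      algAut (A3_2 a1 0 1) =
        [set g | exists c d : F, d != 0 /\ g = mx22 1 0 c d] /\
      algDer (A3_2 a1 0 1) = [set D | exists c d : F, D = mx22 0 0 c d])) /\
  (* 4 *)
  ((forall a1 b1 b2 : F,
      algAut (A4_2 a1 b1 b2) = [set 1%:M; mx22 1 0 (1 + b2) 1]) /\
   (forall a1 b1 b2 : F, b2 != 1 -> algDer (A4_2 a1 b1 b2) = [set 0]) /\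
   (forall a1 b1 : F,
      algDer (A4_2 a1 b1 1) = [set D | exists c : F, D = mx22 0 0 c 0])) /\
  (* 5 *)
  ((forall a1 a4 : F, a4 != 0 ->
      algAut (A5_2 a1 a4) = [set 1%:M] /\
      algDer (A5_2 a1 a4) = [set 0]) /\
   algAut (A5_2 (1 : F) 0) = [set g | exists c : F, g = mx22 1 0 c 1] /\
   algDer (A5_2 (1 : F) 0) = [set D | exists c : F, D = mx22 0 0 c 0]) /\
  (* 6 *)
  ((forall a1 a4 : F, a4 != 0 -> algAut (A6_2 a1 a4) = [set 1%:M]) /\
   (forall a1 : F, a1 != 1 ->
      algAut (A6_2 a1 0) =
        [set g | exists d : F, d != 0 /\ g = mx22 1 0 0 d]) /\
   (forall a1 a4 : F, a1 != 1 \/ a4 != 0 ->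
      algDer (A6_2 a1 a4) = [set D | exists d : F, D = mx22 0 0 0 d]) /\
   algAut (A6_2 (1 : F) 0) =
     [set g | exists c d : F, d != 0 /\ g = mx22 1 0 c d] /\
   algDer (A6_2 (1 : F) 0) = [set D | exists c d : F, D = mx22 0 0 c d]) /\
  (* 7 *)
  ((forall a1 b1 : F,
      algAut (A7_2 a1 b1) = [set 1%:M; mx22 1 0 (a1 + 1) 1]) /\
   (forall a1 b1 : F, a1 != 1 -> algDer (A7_2 a1 b1) = [set 0]) /\
   (forall b1 : F,
      algDer (A7_2 1 b1) = [set D | exists c : F, D = mx22 0 0 c 0])) /\
  (* 8 *)
  ((forall b1 : F, b1 != 0 ->
      algAut (A8_2 b1) =
        [set 1%:M]
        `|` [set g | exists d : F,
               [/\ d ^+ 2 + d + 1 != 0, b1 = 1 / (d ^+ 2 + d + 1)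
                 & g = mx22 (1 + d) (1 + d + d ^+ 2) 1 d]]
        `|` [set g | exists d : F,
               [/\ d != 0, b1 = (1 + d) / d ^+ 3
                 & g = mx22 d (d + d ^+ 2) ((1 + d) / d) d]] /\
      algDer (A8_2 b1) = [set 0]) /\
   algAut (A8_2 (0 : F)) =
     [set g | exists b : F, 1 + b != 0 /\ g = mx22 (1 + b) b 0 1] /\
   algDer (A8_2 (0 : F)) = [set D | exists a c : F, D = mx22 a a c c]) /\
  (* 9 *)
  ((forall b1 : F, b1 != 0 ->
      algAut (A9_2 b1) =
        [set g | exists d : F, d ^+ 3 = 1 /\ g = mx22 (d ^+ 2) 0 0 d]
        `|` [set g | exists b : F,
               [/\ b != 0, b1 = 1 / b ^+ 3 & g = mx22 0 b (1 / b) 0]] /\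
      algDer (A9_2 b1) = [set 0]) /\
   algAut (A9_2 (0 : F)) =
     [set g | exists b d : F, d != 0 /\ g = mx22 (d ^+ 2) b 0 d] /\
   algDer (A9_2 (0 : F)) = [set D | exists b d : F, D = mx22 0 b 0 d]) /\
  (* 10 *)
  (forall b1 : F,
     algAut (A10_2 b1) =
       [set 1%:M; mx22 1 0 1 1]
       `|` [set g | exists d : F, b1 = d + d ^+ 2 /\
              [\/ g = mx22 d 1 (1 + d ^+ 2) d,
                  g = mx22 d 1 (1 + d + d ^+ 2) (1 + d),
                  g = mx22 (1 + d) 1 (1 + d + d ^+ 2) d
                | g = mx22 (1 + d) 1 (d ^+ 2) (1 + d)]] /\
     algDer (A10_2 b1) = [set 0]) /\
  (* 11 *)
  (forall b1 : F,
     algAut (A11_2 b1) =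
       [set g | exists a c : F,
          [/\ a != 0, c ^+ 2 = (1 + a ^+ 2) * b1 & g = mx22 a 0 c 1]] /\
     algDer (A11_2 b1) = [set D | exists a c : F, D = mx22 a 0 c 0]).
Proof.
have two0 : 1 + 1 = 0 :> F by exact: addrr_pchar2.
have sA2 := shear_coef_A2_A3_A4 charF2; have sA5 := shear_coef_A5_A6_A7 charF2.
have add1 x : x != 1 -> 1 + x != 0 :> F := @char2_add1_neq0 F charF2 x.
have trA2 a1 a4 b1 b2 := unit_trace_A2_A3 charF2 a1 a4 b1 b2.
have trA5 a1 a4 b1 := unit_trace_A5_A6 charF2 a1 a4 b1.
have trA4 a1 b1 b2 := unit_trace_A4 charF2 a1 b1 b2.
have trA7 a1 b1 := unit_trace_A7 charF2 a1 b1.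
split; last split; last split; last split; last split; last split;
  last split; last split; last split; last split.
- by split; [exact: algAut_A1_2 | exact: algDer_A1_2].
- split=> [a1 a4 b2 adm | a1].
    split=> [a40 | a4b2]; first exact: algAut_mixed_trivial.
    apply: algDer_mixed_trivial => //.
    (* An admissible triple with b2 != 1 has a4 != 0. *)
    by case: adm => [// | [_ b21]]; case: a4b2; rewrite // b21 eqxx.
  by split; [apply: algAut_mixed_shear | apply: algDer_mixed_shear];
    rewrite // sA2.
- split=> [a1 a4 b2 a40 |].
    (* In characteristic 2 the two listed matrices coincide. *)
    rewrite oppr_pchar2 // setUid -mx22_1; exact: algAut_mixed0_trivial.
  split=> [a1 b2 b21 |].
    by apply: algAut_mixed0_diag; rewrite // sA2 add1.
  split=> [a1 a4 b2 a4b2 |].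
    apply: algDer_mixed0_diag => //; rewrite sA2.
    by case: a4b2 => [|/add1]; [left | right].
  by move=> a1; split; [apply: algAut_mixed0_triangular
    | apply: algDer_mixed0_triangular]; rewrite // sA2.
- split=> [a1 b1 b2 |]; first by rewrite -(sA2 a1); exact: algAut_idem_pair.
  split=> [a1 b1 b2 b21 | a1 b1].
    by apply: algDer_idem_trivial; rewrite // sA2 add1.
  by apply: algDer_idem_shear; rewrite // sA2.
- split=> [a1 a4 a40 |].
    by split; [exact: algAut_mixed_trivial | exact: algDer_mixed_trivial].
  by split; [apply: algAut_mixed_shear | apply: algDer_mixed_shear];
    rewrite // sA5.
- split=> [a1 a4 a40 |]; first exact: algAut_mixed0_trivial.
  split=> [a1 a11 |].
    by apply: algAut_mixed0_diag; rewrite // sA5 addrC add1.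
  split=> [a1 a4 a1a4 |].
    apply: algDer_mixed0_diag => //; rewrite sA5 addrC.
    by case: a1a4 => [/add1|]; [right | left].
  by split; [apply: algAut_mixed0_triangular | apply: algDer_mixed0_triangular];
    rewrite // sA5.
- split=> [a1 b1 |]; first by rewrite -(sA5 a1); exact: algAut_idem_pair.
  split=> [a1 b1 a11 | b1].
    by apply: algDer_idem_trivial; rewrite // sA5 addrC add1.
  by apply: algDer_idem_shear; rewrite // sA5.
- split=> [b1 b10 |].
    by split; [exact: algAut_A8_2 | exact: algDer_A8_2].
  by split; [exact: algAut_A8_2_0 | exact: algDer_A8_2_0].
- split=> [b1 b10 |].
    by split; [exact: algAut_A9_2 | exact: algDer_A9_2].
  by split; [exact: algAut_A9_2_0 | exact: algDer_A9_2_0].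
- by move=> b1; split; [exact: algAut_A10_2 | exact: algDer_A10_2].
- by move=> b1; split; [exact: algAut_A11_2 | exact: algDer_A11_2].
Qed.
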